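(* For a given simple undirected graph $\mathcal{G}=(\mathcal{V},\mathcal{E})$ with $n$ vertices and an integer $k\in\{1,\dots,n-1\}$, we have $$\theta_k(\mathcal{G})\le\min\{k\,\vartheta'(\mathcal{G}),\,|\mathcal{V}|\},$$ where $\vartheta'(\mathcal{G})$ is the Schrijver number of $\mathcal{G}$.
   Context: With $\mathcal{V}=\{1,\dots,n\}$ and $k\ge1$ an integer, $\theta_k(\mathcal{G})$ is the optimal value of the semidefinite program: maximize $\langle I_n,X\rangle=\sum_i X_{ii}$ over real symmetric $n\times n$ matrices $X$ such that $X_{ij}=0$ for all $\{i,j\}\in\mathcal{E}$; the $(n+1)\times(n+1)$ matrix $\begin{pmatrix} k & \mathrm{diag}(X)^\top\\ \mathrm{diag}(X) & X\end{pmatrix}$ is positive semidefinite; $X\ge0$ entrywise; and $X_{ii}\le1$ for all $i$. Here $\mathrm{diag}(X)$ is the vector of diagonal entries of $X$. The Schrijver number $\vartheta'(\mathcal{G})$ is the optimal value of: maximize $\langle J_n,Z\rangle=\sum_{i,j}Z_{ij}$ over real symmetric $n\times n$ matrices $Z$ such that $Z_{ij}=0$ for all $\{i,j\}\in\mathcal{E}$, $\langle I_n,Z\rangle=\mathrm{tr}(Z)=1$, $Z$ and $I_n-Z$ are positive semidefinite (the latter is redundant here), and $Z\ge0$ entrywise. *)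

(* Defs.v *)
From mathcomp Require Import all_boot all_order all_algebra.
From mathcomp Require Import all_classical all_reals all_analysis.

Set Implicit Arguments.
Unset Strict Implicit.
Unset Printing Implicit Defensive.

Import Order.TTheory GRing.Theory Num.Theory.

Local Open Scope classical_set_scope.
Local Open Scope ring_scope.

Definition psdmx (R : realType) (n : nat) (A : 'M[R]_n) : Prop :=
  A \is symmetricmx /\ forall x : 'cV[R]_n, 0 <= (x^T *m A *m x) 0 0.

Definition diag_vec (R : realType) (n : nat) (X : 'M[R]_n) : 'cV[R]_n :=
  \col_i X i i.

Definition theta_feasible (R : realType) (n : nat) (e : rel 'I_n) (k : nat) :
    set 'M[R]_n :=
  [set X | [/\ X \is symmetricmx,
      forall i j, e i j -> X i j = 0,
      psdmx (block_mx (k%:R)%:M (diag_vec X)^T (diag_vec X) X : 'M[R]_(1 + n)),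
      forall i j, 0 <= X i j
    & forall i, X i i <= 1]].

(* Optimal values are suprema in the extended reals, so that no default value
   enters when a program is infeasible or unbounded. *)
Definition theta (R : realType) (n : nat) (e : rel 'I_n) (k : nat) : \bar R :=
  ereal_sup [set (\tr X)%:E | X in @theta_feasible R n e k].

Definition schrijver_feasible (R : realType) (n : nat) (e : rel 'I_n) :
    set 'M[R]_n :=
  [set Z | [/\ Z \is symmetricmx,
      forall i j, e i j -> Z i j = 0,
      \tr Z = 1,
      psdmx Z /\ psdmx (1%:M - Z)
    & forall i j, 0 <= Z i j]].

Definition schrijver (R : realType) (n : nat) (e : rel 'I_n) : \bar R :=
  ereal_sup [set (\sum_i \sum_j Z i j)%:E | Z in @schrijver_feasible R n e].

(* Main.v *)
Require Import Defs.
From mathcomp Require Import all_boot all_order all_algebra.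
From mathcomp Require Import all_classical all_reals all_analysis.
From mathcomp Require Import ring lra.

(** If [X] is feasible for [theta_k] with trace [t > 0], then [Z = X / t] is
    feasible for the Schrijver program. Positivity of the bordered matrix at the
    vector [(- t / k, 1, ..., 1)] gives [t ^ 2 / k <= <J, X>], i.e.
    [t <= k <J, Z>]. The bound by [|V|] comes from [X i i <= 1]. *)

Import Order.TTheory GRing.Theory Num.Theory.
Local Open Scope ring_scope.

Lemma symmetricmxE {R : fieldType} {n : nat} (A : 'M[R]_n) :
  A \is symmetricmx = (A == A^T).
Proof. by rewrite is_hermitianmxE expr0 scale1r map_mx_id. Qed.

Lemma add11 {R : nmodType} (A B : 'M[R]_1) : (A + B) 0 0 = A 0 0 + B 0 0.
Proof. exact: mxE. Qed.

Lemma scale11 {R : pzSemiRingType} (a : R) (A : 'M[R]_1) :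
  (a *: A) 0 0 = a * A 0 0.
Proof. exact: mxE. Qed.

Lemma qformE {R : comPzRingType} {n : nat} (A : 'M[R]_n) (x : 'cV[R]_n) :
  (x^T *m A *m x) 0 0 = \sum_i \sum_j A i j * x i 0 * x j 0.
Proof.
rewrite mxE exchange_big; apply: eq_bigr => j _.
rewrite mxE mulr_suml; apply: eq_bigr => i _.
by rewrite mxE [x i 0 * _]mulrC.
Qed.

Lemma qform_delta2 {R : comPzRingType} {n : nat} (A : 'M[R]_n) (i j : 'I_n)
    (a b : R) (x := a *: delta_mx i 0 + b *: delta_mx j 0 : 'cV[R]_n) :
  (x^T *m A *m x) 0 0 =
  a ^+ 2 * A i i + a * b * (A i j + A j i) + b ^+ 2 * A j j.
Proof.
have qd p q : ((delta_mx p 0 : 'cV[R]_n)^T *m A *m (delta_mx q 0 : 'cV[R]_n))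
    0 0 = A p q by rewrite trmx_delta -rowE -colE !mxE.
have -> : x^T = a *: (delta_mx i 0)^T + b *: (delta_mx j 0)^T.
  by rewrite linearD !linearZ.
rewrite /x !mulmxDl !mulmxDr.
rewrite -!scalemxAl -!scalemxAr.
rewrite !add11 !scale11 !qd.
by ring.
Qed.

Lemma psdmx_scale {R : realType} {n : nat} (c : R) (A : 'M[R]_n) :
  0 <= c -> psdmx A -> psdmx (c *: A).
Proof.
move=> c0 [sA pA]; split.
  by move: sA; rewrite !symmetricmxE linearZ => /eqP {1}->.
by move=> x; rewrite -scalemxAr -scalemxAl mxE mulr_ge0.
Qed.

(** Eigenvalues of a positive semidefinite matrix are nonnegative, so each is at most their sum. The
    proof replaces this spectral argument by a sum of values of the form on combinations of two
    basis vectors. *)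
Lemma psdmx_trace_sub {R : realType} {n : nat} (A : 'M[R]_n) :
  psdmx A -> psdmx ((\tr A)%:M - A).
Proof.
move=> [sA pA]; have /eqP AT : A == A^T by rewrite -symmetricmxE.
have Aij i j : A j i = A i j by rewrite {1}AT mxE.
split.
  by rewrite symmetricmxE linearB /= tr_scalar_mx -AT.
move=> x; rewrite mulmxBr mulmxBl add11 -scaleN1r scale11 mulN1r.
rewrite mul_mx_scalar -scalemxAl scale11 qformE.
set N := (_ *m _) 0 0.
have NE : N = \sum_j x j 0 ^+ 2.
  by rewrite /N mxE; apply: eq_bigr => j _; rewrite mxE expr2.
have tE : \tr A * N = \sum_i \sum_j A i i * x j 0 ^+ 2.
  by rewrite NE mulr_suml; apply: eq_bigr => i _; rewrite mulr_sumr.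
(* Twice the form is the sum over [i, j] of the values of the form of [A]
   at [x_j e_i - x_i e_j]. *)
suff : 0 <= (\tr A * N - \sum_i \sum_j A i j * x i 0 * x j 0) *+ 2.
  by rewrite pmulrn_lge0.
have -> : (\tr A * N - \sum_i \sum_j A i j * x i 0 * x j 0) *+ 2 =
    \sum_i \sum_j (A i i * x j 0 ^+ 2 + A j j * x i 0 ^+ 2
                   - A i j * x i 0 * x j 0 *+ 2).
  under [RHS]eq_bigr do rewrite sumrB big_split /= sumrMnl.
  rewrite sumrB big_split /= sumrMnl -tE.
  rewrite [X in _ + X - _]exchange_big /= -tE.
  by rewrite mulrnBl mulr2n.
apply: sumr_ge0 => i _; apply: sumr_ge0 => j _.
have := pA (x j 0 *: delta_mx i 0 + (- x i 0) *: delta_mx j 0).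
rewrite qform_delta2 Aij => /le_trans; apply.
by rewrite le_eqVlt; apply/orP; left; apply/eqP; ring.
Qed.

Lemma psdmx_delta {R : realType} {n : nat} (i : 'I_n) :
  psdmx (delta_mx i i : 'M[R]_n).
Proof.
split; first by rewrite symmetricmxE trmx_delta.
(* The matrix is the rank-one product of a basis vector with its transpose, so the form is
   [x i 0 ^+ 2]. *)
move=> x; rewrite -(mul_delta_mx (0 : 'I_1)) mulmxA -mulmxA -rowE -colE.
by rewrite mxE big_ord1 !mxE -expr2 sqr_ge0.
Qed.

(** The border coordinate [a] stays a free scalar: [a = 0] isolates the form of [X], and a suitable
    negative [a] bounds the trace. *)
Lemma psdmx_block_scalar {R : realType} {n : nat} (c a : R) (d x : 'cV[R]_n)
    (X : 'M[R]_n) :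
  psdmx (block_mx c%:M d^T d X : 'M[R]_(1 + n)) ->
  0 <= c * a ^+ 2 + a * (d^T *m x) 0 0 *+ 2 + (x^T *m X *m x) 0 0.
Proof.
move=> [_ /(_ (col_mx a%:M x))].
rewrite tr_col_mx mul_row_block mul_row_col tr_scalar_mx.
have xd : (x^T *m d) 0 0 = (d^T *m x) 0 0.
  by rewrite -{1}[d]trmxK -trmx_mul mxE.
rewrite !mulmxDl !mul_mx_scalar !mul_scalar_mx -!scalemxAl.
rewrite !add11 !scale11 xd mxE eqxx mulr1n => /le_trans; apply.
by rewrite le_eqVlt; apply/orP; left; apply/eqP; ring.
Qed.

Lemma theta_feasible_psdmx {R : realType} {n : nat} {e : rel 'I_n} {k : nat}
    {X : 'M[R]_n} : theta_feasible e k X -> psdmx X.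
Proof.
move=> [sX _ /psdmx_block_scalar pX _ _]; split=> // x.
by have := pX 0 x; rewrite expr0n mulr0 !mul0r mul0rn !add0r.
Qed.

Lemma theta_feasible_trace_sqr {R : realType} {n : nat} {e : rel 'I_n}
    {k : nat} {X : 'M[R]_n} :
  (0 < k)%N -> theta_feasible e k X ->
  (\tr X) ^+ 2 <= k%:R * \sum_i \sum_j X i j.
Proof.
move=> k0 [_ _ /psdmx_block_scalar pX _ _].
have {k0} k0 : 0 < k%:R :> R by rewrite ltr0n.
(* With [t] the trace and [S] the sum of the entries of [X], the form is [k a^2 + 2 a t + S]. This
   [a] minimizes it, with value [S - t^2 / k]. *)
have := pX (- \tr X / k%:R) (const_mx 1).
have -> : ((diag_vec X)^T *m (const_mx 1 : 'cV[R]_n)) 0 0 = \tr X.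
  by rewrite mxE; apply: eq_bigr => i _; rewrite !mxE mulr1.
rewrite qformE.
under eq_bigr do under eq_bigr do rewrite !mxE !mulr1.
set S := \sum_i _; set t := \tr X => h.
have := mulr_ge0 (ltW k0) h.
have -> : k%:R * (k%:R * (- t / k%:R) ^+ 2 + - t / k%:R * t *+ 2 + S) =
    k%:R * S - t ^+ 2 by field; rewrite gt_eqF.
by rewrite subr_ge0.
Qed.

Lemma schrijver_feasible_normalize {R : realType} {n : nat} {e : rel 'I_n}
    {k : nat} {X : 'M[R]_n} :
  0 < \tr X -> theta_feasible e k X ->
  schrijver_feasible e ((\tr X)^-1 *: X).
Proof.
move=> t0 fX; have pX := theta_feasible_psdmx fX.
case: fX => _ eX _ X0 _.
have ti0 : 0 <= (\tr X)^-1 by rewrite invr_ge0 ltW.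
have pZ := psdmx_scale _ _ ti0 pX.
have trZ : \tr ((\tr X)^-1 *: X) = 1 by rewrite linearZ /= mulVf ?gt_eqF.
split=> //.
- by case: pZ.
- by move=> i j /eX Xij; rewrite mxE Xij mulr0.
(* Having trace [1], the matrix turns [1%:M] into its own trace times the identity. *)
- by split=> //; rewrite -trZ; exact: psdmx_trace_sub.
- by move=> i j; rewrite mxE mulr_ge0.
Qed.

(** The only nonzero entry is diagonal, and irreflexivity keeps it clear of the edge constraints. *)
Lemma schrijver_feasible_delta {R : realType} {n : nat} {e : rel 'I_n}
    (i : 'I_n) :
  irreflexive e -> schrijver_feasible e (delta_mx i i : 'M[R]_n).
Proof.
move=> irr; have pD := @psdmx_delta R n i.
have trD : \tr (delta_mx i i : 'M[R]_n) = 1.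
  rewrite /mxtrace (bigD1 i) //= mxE eqxx big1 ?addr0 // => j /negPf ji.
  by rewrite mxE ji.
split=> //.
- by case: pD.
- move=> p q epq; rewrite mxE; case: eqP => //= pi; case: eqP => //= qi.
  by rewrite pi qi irr in epq.
- by split=> //; rewrite -trD; exact: psdmx_trace_sub.
- by move=> p q; rewrite mxE ler0n.
Qed.

(** A vertex supplies a feasible matrix. On the empty graph no matrix has trace [1], and the
    supremum would be minus infinity. *)
Lemma schrijver_ge0 {R : realType} {n : nat} {e : rel 'I_n} :
  (0 < n)%N -> irreflexive e -> (0 <= schrijver R e)%E.
Proof.
move=> n0 irr.
have fD := @schrijver_feasible_delta R n e (Ordinal n0) irr.
apply: le_trans (ereal_sup_ubound (imageP _ fD)); rewrite lee_fin.
by case: fD => _ _ _ _ D0; apply: sumr_ge0 => p _; apply: sumr_ge0.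
Qed.

Theorem corollary3p2p1 (R : realType) (n k : nat) (e : rel 'I_n)
    (e_sym : symmetric e) (e_irr : irreflexive e)
    (k_ge1 : (1 <= k)%N) (k_le : (k <= n - 1)%N) :
  (theta R e k <= Order.min (k%:R%:E * schrijver R e) n%:R%:E)%E.
Proof.
apply: ge_ereal_sup => _ [X fX <-]; rewrite le_min; apply/andP; split; last first.
  case: fX => _ _ _ _ X1; rewrite lee_fin.
  apply: (le_trans (ler_sum _ (fun i _ => X1 i))).
  by rewrite sumr_const card_ord.
have n0 : (0 < n)%N by case: n k_le {fX X e e_sym e_irr} => //; case: k k_ge1.
have k0 : (0 <= k%:R%:E :> \bar R)%E by rewrite lee_fin ler0n.
(* A matrix of trace [0] cannot be normalized; there nonnegativity of the Schrijver number
   suffices. *)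
have [t0|t0] := leP (\tr X) 0.
  apply: (@le_trans _ _ 0%E); first by rewrite lee_fin.
  by apply: mule_ge0 => //; exact: schrijver_ge0.
have fZ := schrijver_feasible_normalize t0 fX.
apply: (le_trans _ (lee_wpmul2l k0 (ereal_sup_ubound (imageP _ fZ)))).
rewrite -EFinM lee_fin.
under eq_bigr do under eq_bigr do rewrite mxE.
under eq_bigr do rewrite -mulr_sumr.
(* Multiplying by the positive trace turns [t <= k (S / t)] into [t^2 <= k S]. *)
rewrite -mulr_sumr mulrCA mulrC ler_pdivlMr // -expr2.
exact: theta_feasible_trace_sqr fX.
Qed.
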